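(* Let $k$ be a positive integer. A sequence of integer partitions $(\lambda^{(j)}: j=0,\frac12,1,1\frac12,\dots,k)$ is the limiting vacillating tableau $P^*(\boldsymbol{i})$ of some integer sequence $\boldsymbol{i}$ of length $k$ (of positive integers) if and only if $\lambda^{(0)}=\emptyset$ and the sequence satisfies the following conditions for each integer $j=0,1,\dots,k-1$: (a) $\lambda^{(j)}\supseteq\lambda^{(j+\frac12)}$ and $|\lambda^{(j)}/\lambda^{(j+\frac12)}|=0$ or $1$; (b) $\lambda^{(j+\frac12)}\subseteq\lambda^{(j+1)}$ and $|\lambda^{(j+1)}/\lambda^{(j+\frac12)}|=1$.
   Context: Notation: $[n]=\{1,2,\dots,n\}$. Integer partitions are identified with their Young diagrams (English notation, rows left-justified, row $j$ having $\lambda_j$ boxes, rows numbered from the top); containment $\subseteq$ is containment of diagrams and $|\lambda/\mu|$ is the number of boxes of $\lambda$ not in $\mu$. A partial tableau is a filling of the boxes of an integer partition (its shape) with distinct positive integers increasing along rows (left to right) and down columns. RSK row insertion $x\xrightarrow{RSK}T$, for a partial tableau $T$ and a positive integer $x$ not in $T$: let $R$ be the first row of $T$. While $x$ is less than some element of $R$: let $y$ be the smallest element of $R$ greater than $x$; replace $y$ in $R$ by $x$; set $x:=y$ and let $R$ be the next row. When $x$ is not less than any element of $R$, place $x$ at the end of $R$ (which is possibly empty). The result is a partial tableau. Jeu de taquin deletion $x\xleftarrow{jdt}T$, for a partial tableau $T$ and an entry $x$ of $T$: let $c$ be the box containing $x$, at position $(i,j)$ (row $i$, column $j$). While the position $(i,j)$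 of $x$ is not a corner (a box that is both at the end of its row and at the end of its column), exchange $x$ with the smaller of the entries at positions $(i+1,j)$ and $(i,j+1)$ (if only one of these exists, exchange with that one), and update $(i,j)$ to be the new position of $x$. When $x$ is in a corner, delete that box. The result is a partial tableau. The vacillating tableau $P^k_m(\boldsymbol{i})$, for $\boldsymbol{i}=(i_1,\dots,i_k)\in[m]^k$: let $T^{(0)}$ be the tableau of one row of shape $(m)$ with entries $1,2,\dots,m$. For integers $j=0,1,\dots,k-1$ put $T^{(j+\frac12)}=\left(i_{j+1}\xleftarrow{jdt}T^{(j)}\right)$ and $T^{(j+1)}=\left(i_{j+1}\xrightarrow{RSK}T^{(j+\frac12)}\right)$. Let $\lambda^{(j)}$ be the shape of $T^{(j)}$ for every index $j\in\{0,\frac12,1,1\frac12,\dots,k\}$. Then $P^k_m(\boldsymbol{i})=(\lambda^{(0)},\lambda^{(\frac12)},\lambda^{(1)},\dots,\lambda^{(k-\frac12)},\lambda^{(k)})$. Simplified version: for an integer partition $\lambda=(\lambda_1,\lambda_2,\dots,\lambda_t)$, let $\lambda^*=(\lambda_2,\dots,\lambda_t)$ be obtained by removing the first part. For a sequence $P=(\lambda^{(j)}: j=0,\frac12,1,\dots,k)$ of partitions, $P^*=((\lambda^{(j)})^*: j=0,\frac12,1,\dots,k)$. Limiting vacillating tableau: for $\boldsymbol{i}\in[n]^k$, the sequence $(P^k_m(\boldsymbol{i}))^*$ is the same for all $m>n+2k$; this common value is denoted $P^*(\boldsymbol{i})$ and called the limiting vacillating tableau of $\boldsymbol{i}$. 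*)

(* Defs.v *)
From mathcomp Require Import all_boot.

Set Implicit Arguments.
Unset Strict Implicit.
Unset Printing Implicit Defensive.

(* Partitions are sequences of positive parts without trailing zeros, so that
   equality of partitions is equality of sequences; rows and columns are
   numbered from 0. *)
Definition is_part (la : seq nat) : bool := sorted geq la && (0 \notin la).

Definition diagram (la : seq nat) : seq (nat * nat) :=
  [seq (r, c) | r <- iota 0 (size la), c <- iota 0 (nth 0 la r)].

Definition part_included (mu la : seq nat) : Prop :=
  {subset diagram mu <= diagram la}.

Definition skew_size (la mu : seq nat) : nat :=
  size [seq b <- diagram la | b \notin diagram mu].

(* The list of rows, from the top; no row is empty. *)
Definition tableau := seq (seq nat).

Definition shape (T : tableau) : seq nat := map size T.

Definition has_box (T : tableau) (b : nat * nat) : bool :=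
  b.2 < size (nth [::] T b.1).

Definition entry (T : tableau) (b : nat * nat) : nat :=
  nth 0 (nth [::] T b.1) b.2.

Definition set_entry (T : tableau) (b : nat * nat) (x : nat) : tableau :=
  set_nth [::] T b.1 (set_nth 0 (nth [::] T b.1) b.2 x).

Definition exchange (T : tableau) (b b' : nat * nat) : tableau :=
  set_entry (set_entry T b (entry T b')) b' (entry T b).

(* Rows being increasing, the first entry of R greater than x is the smallest
   one. *)
Fixpoint rsk_insert (x : nat) (T : tableau) : tableau :=
  match T with
  | [::] => [:: [:: x]]
  | R :: T' =>
      let p := find (fun y => x < y) R in
      if p < size R then set_nth 0 R p x :: rsk_insert (nth 0 R p) T'
      else rcons R x :: T'
  end.

(* For a box b at the end of its row; a row that becomes empty disappears. *)
Definition delete_corner (T : tableau) (b : nat * nat) : tableau :=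
  [seq R <- set_nth [::] T b.1 (take b.2 (nth [::] T b.1)) | R != [::]].

(* Slides the entry of box b to a corner, which is then deleted. *)
Fixpoint jdt_slide (fuel : nat) (T : tableau) (b : nat * nat) : tableau :=
  match fuel with
  | 0 => T
  | fuel'.+1 =>
      let down := (b.1.+1, b.2) in
      let right := (b.1, b.2.+1) in
      let go b' := jdt_slide fuel' (exchange T b b') b' in
      match has_box T down, has_box T right with
      | false, false => delete_corner T b
      | true, false => go down
      | false, true => go right
      | true, true => if entry T down < entry T right then go down else go right
      end
  end.

Definition position (x : nat) (T : tableau) : nat * nat :=
  let r := find (fun R => x \in R) T in (r, index x (nth [::] T r)).

(* A slide visits each box at most once, so the number of boxes is enough
   fuel. The value is only meaningful when x is an entry of T. *)
Definition jdt_delete (x : nat) (T : tableau) : tableau :=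
  jdt_slide (size (flatten T)) T (position x T).

(* The shapes of T^(1/2), T^(1), T^(3/2), ..., starting from T^(0) = T. *)
Fixpoint vacillating_from (T : tableau) (i : seq nat) : seq (seq nat) :=
  match i with
  | [::] => [::]
  | x :: i' =>
      let T1 := jdt_delete x T in
      let T2 := rsk_insert x T1 in
      [:: shape T1, shape T2 & vacillating_from T2 i']
  end.

(* The sequence indexed by the half-integers 0, 1/2, 1, ..., k is stored as a
   list of 2k + 1 partitions, the one of index h being at position 2h. *)
Definition vacillating_tableau (m : nat) (i : seq nat) : seq (seq nat) :=
  let T0 := [:: iota 1 m] in shape T0 :: vacillating_from T0 i.

Definition star (la : seq nat) : seq nat := behead la.

(* P is the common value of the simplified vacillating tableaux of i for all
   m > n + 2k, where i is a sequence of positive integers of length k and n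
   is any bound such that i is in [n]^k. *)
Definition is_limiting_vacillating_tableau (i : seq nat) (P : seq (seq nat))
    : Prop :=
  forall n m : nat, {in i, forall x, x <= n} -> n + 2 * size i < m ->
    P = map star (vacillating_tableau m i).

(* Main.v *)
Require Import Defs.
From mathcomp Require Import all_boot zify.

Set Implicit Arguments.
Unset Strict Implicit.
Unset Printing Implicit Defensive.

(** The first row of T^(0) is much longer than anything that happens to it.
    Write n for a bound on the i_j and m for the size of the tableau. A slide
    started at x <= n only pushes x downwards, so it never takes an entry > n
    out of the first row, and an insertion takes at most one. As m > n + k,
    some entry > n remains in the first row and every insertion of x <= n bumps
    an entry out of that row ([bumping_iota]): once the first rows are removed,
    the insertion still adds one box. The deletion removes one box, which is
    invisible after removing first rows exactly when it lies in the first row.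
    This gives the necessity of the conditions ([vacillating_from_steps]).

    The independence of m comes from comparing m with m + 1. Appending an entry
    z larger than all others at the end of the first row commutes with slides
    ([slides_append]) and with insertions that bump in the first row
    ([rsk_append]). So, as long as all the insertions bump, the tableaux built
    from m + 1 are those built from m with m + 1 appended
    ([vacillating_tableau_stable]).

    Conversely, given a sequence satisfying the conditions, fix m large enough
    and complete each partition by a first row, so that the sizes are m at the
    integer indices and m - 1 at the half-integer ones; consecutive shapes then
    differ by exactly one box. Start from any standard tableau of the last
    shape and go backwards: an insertion ending in a prescribed corner can be
    undone ([rsk_reverse]), which yields the entry x, and then a slide of x
    that vacates a prescribed corner can be undone ([jdt_reverse]). The
    tableau reached at index 0 is standard with one row and entries 1, ..., m,
    so it is T^(0), and the extracted entries form the sequence i. The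
    insertions in this run all add their box below the first row, hence bump,
    and stability carries the result from this m to every m > n + 2k. *)

(** * Adding one box to a partition *)

Definition adds_box (r : nat) (mu la : seq nat) : Prop :=
  forall i, nth 0 la i = nth 0 mu i + (i == r).

Lemma mem_diagram (la : seq nat) (b : nat * nat) :
  (b \in diagram la) = (b.2 < nth 0 la b.1).
Proof.
apply/idP/idP => [/allpairsPdep[r [c [_]]]|].
  by rewrite mem_iota => /andP[_ lt_c] ->.
case: b => r c /= lt_c; apply/allpairsPdep; exists r, c.
rewrite !mem_iota; split=> //=.
by case: ltnP => // /(nth_default 0) nr0; rewrite nr0 in lt_c.
Qed.

Lemma uniq_diagram (la : seq nat) : uniq (diagram la).
Proof.
apply: allpairs_uniq_dep => [|r _|]; try exact: iota_uniq.
by case=> [r c] [r' c'] _ _ /= [<- <-].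
Qed.

Lemma adds_box_skew_size (r : nat) (mu la : seq nat) :
  adds_box r mu la -> part_included mu la /\ skew_size la mu = 1.
Proof.
move=> add; split=> [b|]; first by rewrite !mem_diagram add => ?; lia.
rewrite /skew_size; apply: (@perm_size _ _ [:: (r, nth 0 mu r)]).
apply: uniq_perm => [||[i j]] //; first exact/filter_uniq/uniq_diagram.
rewrite mem_filter !mem_diagram inE xpair_eqE /= add.
by case: eqP => [->|_] /=; lia.
Qed.

Lemma skew_size_same (mu la : seq nat) :
  nth 0 la =1 nth 0 mu -> part_included mu la /\ skew_size la mu = 0.
Proof.
move=> eq_nth; split=> [b|]; first by rewrite !mem_diagram eq_nth.
apply/eqP; rewrite size_eq0 -[_ == _]negbK -has_filter; apply/hasPn => b.
by rewrite !mem_diagram eq_nth => ->.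
Qed.

Lemma part_included_nth (mu la : seq nat) :
  part_included mu la -> forall i, nth 0 mu i <= nth 0 la i.
Proof.
move=> sub i; rewrite leqNgt; apply/negP => lt.
by have := sub (i, nth 0 la i); rewrite !mem_diagram /= lt ltnn => /(_ isT).
Qed.

(** A row of la longer than the corresponding row of mu contributes all its boxes
    beyond mu to the skew diagram, so there is one such row and it is longer by
    one. *)
Lemma adds_box_of_skew_size (mu la : seq nat) :
  part_included mu la -> skew_size la mu = 1 -> exists r, adds_box r mu la.
Proof.
move=> sub; rewrite /skew_size.
case def: [seq _ <- _ | _] => [|[r c] [|]] //= _; exists r => i.
have in_skew i' j :
    (nth 0 mu i' <= j < nth 0 la i') = ((i' == r) && (j == c)).
  have := mem_filter (fun b => b \notin diagram mu) (i', j) (diagram la).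
  by rewrite def inE xpair_eqE !mem_diagram /= -leqNgt => ->.
have le := part_included_nth sub i.
have := in_skew i (nth 0 mu i); have := in_skew i (nth 0 mu i).+1.
by have := in_skew i c; case: (i == r) => /=; lia.
Qed.

Lemma same_of_skew_size (mu la : seq nat) :
  part_included mu la -> skew_size la mu = 0 -> nth 0 la =1 nth 0 mu.
Proof.
move=> sub /size0nil/eqP; rewrite -[_ == _]negbK -has_filter => /hasPn none i.
have le := part_included_nth sub i; apply/eqP; rewrite eqn_leq le andbT leqNgt.
apply/negP => lt; have := none (i, nth 0 mu i).
by rewrite !mem_diagram /= lt ltnn => /(_ isT).
Qed.

Lemma is_part_nth_gt0 (la : seq nat) :
  is_part la -> forall i, i < size la -> 0 < nth 0 la i.
Proof.
case/andP=> _ no0 i lt_i; rewrite lt0n; apply: contraNneq no0 => <-.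
exact: mem_nth.
Qed.

Lemma is_part_nth_geq (la : seq nat) :
  is_part la -> forall i j, i <= j -> nth 0 la j <= nth 0 la i.
Proof.
case/andP=> srt _ i j le_ij; case: (ltnP j (size la)) => [lt_j|]; last first.
  by move=> ?; rewrite (nth_default 0).
have geq_trans : transitive geq by move=> a b c /= ? ?; lia.
have geq_refl : reflexive geq by move=> a /=.
apply: (sorted_leq_nth geq_trans geq_refl 0 srt) => //.
exact: leq_ltn_trans le_ij lt_j.
Qed.

Lemma part_ext (la mu : seq nat) :
  0 \notin la -> 0 \notin mu -> nth 0 la =1 nth 0 mu -> la = mu.
Proof.
elim: la mu => [|a la IH] [|b mu] //=.
- by rewrite inE negb_or => _ /andP[b0 _] /(_ 0) /= b0'; rewrite -b0' in b0.
- by rewrite inE negb_or => /andP[a0 _] _ /(_ 0) /= a0'; rewrite a0' in a0.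
rewrite !inE !negb_or => /andP[_ nla] /andP[_ nmu] eq_nth.
by have /= -> := eq_nth 0; rewrite (IH mu) // => i; exact: (eq_nth i.+1).
Qed.

Lemma sumn_nth (la : seq nat) (n : nat) :
  size la <= n -> sumn la = \sum_(i < n) nth 0 la i.
Proof.
elim: la n => [|a la IH] [|n] //= le_n.
- by rewrite big_ord0.
- by rewrite big1 // => i _; rewrite nth_nil.
- by rewrite big_ord_recl (IH n).
Qed.

Lemma sumn_add_box (r : nat) (mu la : seq nat) :
  adds_box r mu la -> sumn la = (sumn mu).+1.
Proof.
move=> add; pose n := maxn r.+1 (maxn (size la) (size mu)).
have [lt_r le_la le_mu] : [/\ r < n, size la <= n & size mu <= n] by split; lia.
rewrite (sumn_nth le_la) (sumn_nth le_mu).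
rewrite (eq_bigr _ (fun i _ => add (nat_of_ord i))) big_split /=.
rewrite (bigD1 (P := predT) (F := fun i : 'I_n => i == r :> nat : nat)
           (Ordinal lt_r)) //=.
rewrite eqxx [X in _ + (_ + X)]big1 ?addn1 // => i.
by rewrite -val_eqE /= => /negPf->.
Qed.

(** * Boxes and entries of a tableau *)

Definition down (b : nat * nat) : nat * nat := (b.1.+1, b.2).
Definition right (b : nat * nat) : nat * nat := (b.1, b.2.+1).

Lemma has_box_row (T : tableau) (b : nat * nat) : has_box T b -> b.1 < size T.
Proof.
rewrite /has_box => lt; case: (ltnP b.1 (size T)) lt => // le.
by rewrite nth_default.
Qed.

Lemma has_box_shape (T : tableau) (b : nat * nat) :
  has_box T b = (b.2 < nth 0 (shape T) b.1).
Proof.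
rewrite /has_box /shape.
case: (ltnP b.1 (size T)) => lt; first by rewrite (nth_map [::]).
by rewrite !nth_default ?size_map.
Qed.

Lemma nth_shape (T : tableau) (r : nat) :
  nth 0 (shape T) r = size (nth [::] T r).
Proof.
rewrite /shape; case: (ltnP r (size T)) => lt; first by rewrite (nth_map [::]).
by rewrite !nth_default ?size_map.
Qed.

Lemma row_set_entry (T : tableau) (b : nat * nat) (x r : nat) :
  nth [::] (set_entry T b x) r =
  if r == b.1 then set_nth 0 (nth [::] T b.1) b.2 x else nth [::] T r.
Proof. by rewrite /set_entry nth_set_nth. Qed.

Lemma entry_set_entry (T : tableau) (b c : nat * nat) (x : nat) :
  entry (set_entry T b x) c = if c == b then x else entry T c.
Proof.
case: b c => [r j] [r' j']; rewrite /entry /set_entry nth_set_nth xpair_eqE /=.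
by case: (r' =P r) => [->|_] //; rewrite nth_set_nth.
Qed.

Lemma shape_set_entry (T : tableau) (b : nat * nat) (x : nat) :
  has_box T b -> shape (set_entry T b x) = shape T.
Proof.
move=> hb; have lt_b := has_box_row hb.
apply: (@eq_from_nth _ 0) => [|r _].
  by rewrite !size_map size_set_nth; lia.
rewrite !nth_shape nth_set_nth /=; case: eqP => [->|] //.
by rewrite size_set_nth; move: hb; rewrite /has_box; lia.
Qed.

Lemma eq_has_box (T T' : tableau) :
  shape T = shape T' -> has_box T =1 has_box T'.
Proof. by move=> eq_sh b; rewrite !has_box_shape eq_sh. Qed.

Lemma tableau_ext (T T' : tableau) :
    shape T = shape T' ->
    (forall b, has_box T b -> entry T b = entry T' b) ->
  T = T'.
Proof.
move=> eq_sh eq_e.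
have eq_size r : size (nth [::] T r) = size (nth [::] T' r).
  by rewrite -!nth_shape eq_sh.
apply: (@eq_from_nth _ [::]) => [|r _].
  by rewrite -[size T](size_map size) -[size T'](size_map size) -/(shape T) eq_sh.
by apply: (@eq_from_nth _ 0) => [|c lt_c]; [|exact: (eq_e (r, c))].
Qed.

Lemma shape_exchange (T : tableau) (b b' : nat * nat) :
  has_box T b -> has_box T b' -> shape (exchange T b b') = shape T.
Proof.
move=> hb hb'; have sh := shape_set_entry (entry T b') hb.
by rewrite shape_set_entry ?(eq_has_box sh).
Qed.

Lemma entry_exchange (T : tableau) (b b' c : nat * nat) :
  entry (exchange T b b') c =
  if c == b' then entry T b else if c == b then entry T b' else entry T c.
Proof. by rewrite !entry_set_entry. Qed.

Lemma count_flatten_set_nth (a : pred nat) (T : tableau) (r : nat) (R : seq nat) :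
  count a (flatten (set_nth [::] T r R)) + count a (nth [::] T r) =
  count a (flatten T) + count a R.
Proof.
elim: T r => [|R0 T IH] [|r] /=; rewrite ?count_cat //=; try lia.
  by rewrite addn0; elim: r => [|r IHr] //=; rewrite cats0.
by have := IH r; lia.
Qed.

Lemma count_row_set_nth (a : pred nat) (R : seq nat) (c x : nat) :
  c < size R ->
  count a (set_nth 0 R c x) + a (nth 0 R c) = count a R + a x.
Proof.
elim: R c => [|y R IH] [|c] //=; first by lia.
by rewrite ltnS => /IH; lia.
Qed.

Lemma perm_exchange (T : tableau) (b b' : nat * nat) :
  has_box T b -> has_box T b' ->
  perm_eq (flatten (exchange T b b')) (flatten T).
Proof.
move=> hb hb'; apply/permP => /= a.
have count_set T1 c x : has_box T1 c ->
    count a (flatten (set_entry T1 c x)) + a (entry T1 c) =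
    count a (flatten T1) + a x.
  move=> hc.
  have := count_flatten_set_nth a T1 c.1 (set_nth 0 (nth [::] T1 c.1) c.2 x).
  have := count_row_set_nth a x hc; rewrite /set_entry /entry. lia.
have hb1 : has_box (set_entry T b (entry T b')) b'.
  by rewrite (eq_has_box (shape_set_entry _ hb)).
have := count_set _ _ (entry T b) hb1; have := count_set _ _ (entry T b') hb.
rewrite entry_set_entry /exchange; case: eqP => [->|_]; lia.
Qed.

Lemma mem_tableauP (T : tableau) (x : nat) :
  reflect (exists2 b, has_box T b & entry T b = x) (x \in flatten T).
Proof.
apply: (iffP flattenP) => [[R inR inx]|[[r c] hb <-]].
  exists (index R T, index x R); rewrite /has_box /entry /= nth_index //.
    by rewrite index_mem.
  by rewrite nth_index.
exists (nth [::] T r); apply: mem_nth => //; exact: has_box_row hb.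
Qed.

Lemma positionP (T : tableau) (x : nat) :
  x \in flatten T -> has_box T (position x T) /\ entry T (position x T) = x.
Proof.
case/flattenP=> R inR inx; rewrite /position /has_box /entry /=.
have inx' : x \in nth [::] T (find (fun R => x \in R) T).
  by apply: (@nth_find _ [::] (fun R => x \in R)); apply/hasP; exists R.
by rewrite index_mem inx' nth_index.
Qed.

(** Distinctness of entries is carried along as [uniq (flatten T)], which is
    invariant under [perm_eq]; the geometric arguments use it in this form. *)
Lemma uniq_entry_inj (T : tableau) (a b : nat * nat) :
  uniq (flatten T) -> has_box T a -> has_box T b -> entry T a = entry T b -> a = b.
Proof.
elim: T a b => [|R T IH] [r c] [r' c']; first by rewrite /has_box nth_nil.
rewrite /= cat_uniq => /and3P[uR /hasPn disj uT].
have off i j : has_box (R :: T) (i.+1, j) -> entry (R :: T) (i.+1, j) \notin R.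
  move=> hb; apply: disj; apply/mem_tableauP; exists (i, j) => //.
case: r r' => [|r] [|r'] ha hb.
- by rewrite /entry /= => /eqP; rewrite nth_uniq // => /eqP->.
- by move=> eq_e; case/negP: (off _ _ hb); rewrite -eq_e; exact: mem_nth.
- by move=> eq_e; case/negP: (off _ _ ha); rewrite eq_e; exact: mem_nth.
by move=> /(IH (r, c) (r', c') uT ha hb) [-> ->].
Qed.

(** * Slides as a relation *)

Definition slide_next (T : tableau) (b : nat * nat) : option (nat * nat) :=
  match has_box T (down b), has_box T (right b) with
  | false, false => None
  | true, false => Some (down b)
  | false, true => Some (right b)
  | true, true =>
      Some (if entry T (down b) < entry T (right b) then down b else right b)
  end.

(** A fuel-free description of sliding: it allows induction along the path of the
    slide, and lets a path be extended at its beginning when a slide is undone. *)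
Inductive slides : tableau -> nat * nat -> tableau -> Prop :=
| SlideStop T b of slide_next T b = None : slides T b (delete_corner T b)
| SlideStep T b b' T' of slide_next T b = Some b'
    & slides (exchange T b b') b' T' : slides T b T'.

Lemma slide_next_box (T : tableau) (b b' : nat * nat) :
  slide_next T b = Some b' -> has_box T b' /\ (b' = down b \/ b' = right b).
Proof.
rewrite /slide_next; case hd: has_box; case hr: has_box => //.
- by case: ifP => _ [<-]; auto.
- by case=> <-; auto.
- by case=> <-; auto.
Qed.

Lemma slide_next_None (T : tableau) (b : nat * nat) :
  slide_next T b = None -> ~~ has_box T (down b) /\ ~~ has_box T (right b).
Proof. by rewrite /slide_next; case: has_box; case: has_box. Qed.

Lemma jdt_slideS (f : nat) (T : tableau) (b : nat * nat) :
  jdt_slide f.+1 T b =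
  if slide_next T b is Some b' then jdt_slide f (exchange T b b') b'
  else delete_corner T b.
Proof.
rewrite /slide_next /= /down /right; case: has_box; case: has_box => //.
by case: ifP.
Qed.

(** The number of boxes from b onwards in reading order. Both moves go forward in
    that order, which bounds the number of moves by the number of boxes. *)
Definition slide_room (T : tableau) (b : nat * nat) : nat :=
  sumn (drop b.1 (shape T)) - b.2.

Lemma slide_room_next (T : tableau) (b b' : nat * nat) :
    has_box T b -> slide_next T b = Some b' ->
  slide_room (exchange T b b') b' < slide_room T b.
Proof.
move=> hb /slide_next_box[hb' nxt]; rewrite /slide_room shape_exchange //.
have lt_b := has_box_row hb; move: (hb); rewrite has_box_shape => ltb2.
rewrite [X in _ < sumn X - _](drop_nth 0) ?size_map //=.
case: nxt => -> /=; first lia.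
by rewrite (drop_nth 0) ?size_map //=; lia.
Qed.

Lemma jdt_slide_slides (f : nat) (T : tableau) (b : nat * nat) :
  has_box T b -> slide_room T b <= f -> slides T b (jdt_slide f T b).
Proof.
elim: f T b => [|f IH] T b hb room.
  have := hb; rewrite has_box_shape; move: room; rewrite /slide_room.
  by rewrite (drop_nth 0) ?size_map ?(has_box_row hb) //=; lia.
rewrite jdt_slideS; case nxt: slide_next => [b'|]; last exact: SlideStop.
have [hb' _] := slide_next_box nxt; apply: (SlideStep nxt); apply: IH.
  by rewrite (eq_has_box (shape_exchange hb hb')).
by have := slide_room_next hb nxt; lia.
Qed.

Lemma slides_inv (T T' : tableau) (b : nat * nat) :
  slides T b T' ->
  if slide_next T b is Some b' then slides (exchange T b b') b' T'
  else T' = delete_corner T b.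
Proof. by case=> [T1 b1 ->|T1 b1 b' T2 ->]. Qed.

Lemma slides_inj (T T1 T2 : tableau) (b : nat * nat) :
  slides T b T1 -> slides T b T2 -> T1 = T2.
Proof.
move=> sl; elim: sl T2 => {T b T1} [T b nxt|T b b' T1 nxt _ IH] T2 /slides_inv.
  by rewrite nxt.
by rewrite nxt => /IH.
Qed.

Lemma jdt_delete_slides (T T' : tableau) (x : nat) :
    x \in flatten T ->
  slides T (position x T) T' <-> jdt_delete x T = T'.
Proof.
move=> /positionP[hb _].
have sl : slides T (position x T) (jdt_delete x T).
  apply: jdt_slide_slides => //; rewrite /slide_room size_flatten.
  rewrite -{2}(cat_take_drop (position x T).1 (shape T)) sumn_cat; lia.
by split=> [/(slides_inj sl)|<-].
Qed.

(** * Effect of a slide *)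

Lemma rows_ext (T T' : tableau) :
    0 \notin shape T -> 0 \notin shape T' -> nth [::] T =1 nth [::] T' ->
  T = T'.
Proof.
move=> T0 T'0 eq_rows; apply: tableau_ext => [|b _]; last by rewrite /entry eq_rows.
by apply: part_ext => // r; rewrite !nth_shape eq_rows.
Qed.

Lemma row_gt0 (T : tableau) (r : nat) :
  0 \notin shape T -> (0 < size (nth [::] T r)) = (r < size T).
Proof.
move=> T0; case: (ltnP r (size T)) => lt; last by rewrite nth_default.
rewrite lt0n; apply: contraNneq T0 => <-; rewrite -nth_shape.
by apply: mem_nth; rewrite size_map.
Qed.

(** [delete_corner] discards empty rows; this does not renumber the other rows when
    the empty ones all come last. *)
Lemma nth_filter_nonempty (T : tableau) :
    (forall i j, i < j -> nth [::] T i = [::] -> nth [::] T j = [::]) ->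
  nth [::] [seq R <- T | R != [::]] =1 nth [::] T.
Proof.
elim: T => [|R T IH] // tail_nil r /=; case: eqP => [R0|_] /=; last first.
  case: r => //= r; apply: IH => i j lt_ij; exact: (tail_nil i.+1 j.+1).
have all_nil j : nth [::] T j = [::] by exact: (tail_nil 0 j.+1).
have -> : [seq R <- T | R != [::]] = [::].
  apply/eqP; rewrite -[_ == _]negbK -has_filter; apply/hasPn => R' R'T.
  by rewrite negbK -(nth_index [::] R'T) all_nil.
by rewrite nth_nil; case: r => /=.
Qed.

Lemma corner_col (T : tableau) (b : nat * nat) :
  has_box T b -> ~~ has_box T (right b) -> size (nth [::] T b.1) = b.2.+1.
Proof. by rewrite /has_box /=; lia. Qed.

(** If the row of b becomes empty, then b is in the first column with nothing below
    it, so its row was the last one. *)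
Lemma nth_delete_corner (T : tableau) (b : nat * nat) :
    0 \notin shape T -> has_box T b -> slide_next T b = None ->
  forall r, nth [::] (delete_corner T b) r =
    if r == b.1 then take b.2 (nth [::] T b.1) else nth [::] T r.
Proof.
move=> T0 hb /slide_next_None[nd nr] r.
rewrite /delete_corner nth_filter_nonempty ?nth_set_nth //= => i j lt_ij.
rewrite !nth_set_nth /=; have lt_b := has_box_row hb.
have sz : (size T <= i) -> j != b.1 -> nth [::] T j = [::].
  by move=> le _; rewrite nth_default //; lia.
case: eqP => [eq_i|_] /eqP; rewrite -size_eq0.
  rewrite size_takel => [/eqP b0|]; last exact: ltnW hb.
  case: eqP => [|_]; first lia.
  have : ~~ (0 < size (nth [::] T b.1.+1)) by move: nd; rewrite /has_box /= b0.
  by rewrite row_gt0 // -leqNgt => le; rewrite nth_default //; lia.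
rewrite -leqn0 leqNgt row_gt0 // -leqNgt => le.
by case: eqP => [|_]; [lia | rewrite nth_default //; lia].
Qed.

Lemma no_empty_row_delete (T : tableau) (b : nat * nat) :
  0 \notin shape (delete_corner T b).
Proof.
apply/negP => /mapP[R]; rewrite mem_filter => /andP[R0 _] /esym/size0nil.
exact/eqP.
Qed.

Lemma adds_box_delete_corner (T : tableau) (b : nat * nat) :
    0 \notin shape T -> has_box T b -> slide_next T b = None ->
  adds_box b.1 (shape (delete_corner T b)) (shape T).
Proof.
move=> T0 hb nxt r; rewrite !nth_shape (nth_delete_corner T0 hb nxt).
have [_ nr] := slide_next_None nxt; have := corner_col hb nr.
by case: eqP => [->|_] sz; rewrite ?addn0 // size_takel // sz ?addn1.
Qed.

Lemma row_corner (T : tableau) (b : nat * nat) :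
    has_box T b -> ~~ has_box T (right b) ->
  nth [::] T b.1 = rcons (take b.2 (nth [::] T b.1)) (entry T b).
Proof.
by move=> hb /(corner_col hb) sz; rewrite /entry -take_nth ?sz // -sz take_size.
Qed.

Lemma perm_delete_corner (T : tableau) (b : nat * nat) :
    has_box T b -> ~~ has_box T (right b) ->
  perm_eq (flatten T) (entry T b :: flatten (delete_corner T b)).
Proof.
move=> hb nr.
have -> : flatten (delete_corner T b)
        = flatten (set_nth [::] T b.1 (take b.2 (nth [::] T b.1))).
  rewrite /delete_corner; elim: (set_nth _ _ _ _) => //= R S IH.
  by case: eqP => [->|_] /=; rewrite IH.
apply/permP => /= a.
have := count_flatten_set_nth a T b.1 (take b.2 (nth [::] T b.1)).
by rewrite {2}(row_corner hb nr) -cats1 count_cat /=; lia.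
Qed.

(** Induction along a slide, with the facts about rows and boxes that [exchange]
    preserves made available at each move. *)
Lemma slides_ind_box (P : tableau -> nat * nat -> tableau -> Prop) :
    (forall T b, 0 \notin shape T -> has_box T b -> slide_next T b = None ->
       P T b (delete_corner T b)) ->
    (forall T b b' T', 0 \notin shape T -> has_box T b ->
       slide_next T b = Some b' -> has_box T b' -> b' = down b \/ b' = right b ->
       P (exchange T b b') b' T' -> P T b T') ->
  forall T b T', 0 \notin shape T -> has_box T b -> slides T b T' -> P T b T'.
Proof.
move=> Pstop Pstep T b T' T0 hb sl.
elim: sl T0 hb => {T b T'} [T b nxt|T b b' T' nxt _ IH] T0 hb; first exact: Pstop.
have [hb' adj] := slide_next_box nxt; apply: (Pstep _ _ b') => //.
have sh := shape_exchange hb hb'.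
by apply: IH; rewrite ?sh // (eq_has_box sh).
Qed.

Lemma entry_exchange_r (T : tableau) (b b' : nat * nat) :
  entry (exchange T b b') b' = entry T b.
Proof. by rewrite entry_exchange eqxx. Qed.

Lemma slides_perm (T T' : tableau) (b : nat * nat) :
    0 \notin shape T -> has_box T b -> slides T b T' ->
  perm_eq (flatten T) (entry T b :: flatten T').
Proof.
move: T b T'; apply: slides_ind_box => [T b _ hb nxt|T b b' T' _ hb _ hb' _].
  by apply: perm_delete_corner => //; case: (slide_next_None nxt).
by rewrite entry_exchange_r; apply: perm_trans; rewrite perm_sym perm_exchange.
Qed.

Lemma slides_no_empty_row (T T' : tableau) (b : nat * nat) :
  0 \notin shape T -> has_box T b -> slides T b T' -> 0 \notin shape T'.
Proof.
by move: T b T'; apply: slides_ind_box => // T b _ _ _; exact: no_empty_row_delete.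
Qed.

Lemma slides_adds_box (T T' : tableau) (b : nat * nat) :
    0 \notin shape T -> has_box T b -> slides T b T' ->
  exists r, adds_box r (shape T') (shape T).
Proof.
move: T b T'; apply: slides_ind_box => [T b T0 hb nxt|T b b' T' _ hb _ hb' _].
  by exists b.1; exact: adds_box_delete_corner.
by rewrite shape_exchange.
Qed.

Lemma count_head_exchange (a : pred nat) (T : tableau) (b b' : nat * nat) :
    has_box T b -> has_box T b' -> b.1 <= b'.1 -> ~~ a (entry T b) ->
  count a (nth [::] T 0) <= count a (nth [::] (exchange T b b') 0).
Proof.
move=> hb hb' le_b nax.
have head_set T1 c x : has_box T1 c ->
    count a (nth [::] (set_entry T1 c x) 0) + (c.1 == 0) * a (entry T1 c) =
    count a (nth [::] T1 0) + (c.1 == 0) * a x.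
  case: c => [[|r] c] hc; rewrite /set_entry nth_set_nth /= ?mul1n ?mul0n //.
  exact: count_row_set_nth.
have hb1 : has_box (set_entry T b (entry T b')) b'.
  by rewrite (eq_has_box (shape_set_entry _ hb)).
have := head_set _ _ (entry T b) hb1; have := head_set _ _ (entry T b') hb.
rewrite entry_set_entry /exchange (negPf nax).
case: (b' =P b) => [->|_]; first lia.
case: b hb {hb1} le_b nax => [[|r] c] _ /= le_b nax;
  by case: b' hb' le_b => [[|r'] c'] //= _ _; lia.
Qed.

(** Apart from the sliding entry, entries move left or up only, so those selected by
    a stay in the first row once they are there. *)
Lemma slides_count_head (a : pred nat) (T T' : tableau) (b : nat * nat) :
    ~~ a (entry T b) -> 0 \notin shape T -> has_box T b -> slides T b T' ->
  count a (nth [::] T 0) <= count a (nth [::] T' 0).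
Proof.
move=> nax T0 hb sl; move: T b T' T0 hb sl nax.
apply: slides_ind_box => [T b T0 hb nxt|T b b' T' _ hb _ hb' adj IH] nax.
  rewrite nth_delete_corner //; case: eqP => // ->.
  rewrite {1}row_corner //; last by case: (slide_next_None nxt).
  by rewrite -cats1 count_cat /= (negPf nax) !addn0.
rewrite entry_exchange_r in IH; apply: leq_trans (IH nax).
by apply: count_head_exchange => //; case: adj => -> /=; lia.
Qed.

(** * Appending a largest entry to the first row *)

Definition append_first_row (z : nat) (T : tableau) : tableau :=
  set_nth [::] T 0 (rcons (nth [::] T 0) z).

Lemma nth_append_first_row (z : nat) (T : tableau) (r : nat) :
  nth [::] (append_first_row z T) r =
  if r == 0 then rcons (nth [::] T 0) z else nth [::] T r.
Proof. by rewrite nth_set_nth. Qed.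

Lemma has_box_append (z : nat) (T : tableau) (b : nat * nat) :
  has_box (append_first_row z T) b =
  has_box T b || (b == (0, size (nth [::] T 0))).
Proof.
case: b => r c; rewrite /has_box nth_append_first_row xpair_eqE /=.
by case: eqP => [->|_] /=; rewrite ?orbF // size_rcons ltnS leq_eqVlt orbC.
Qed.

Lemma entry_append (z : nat) (T : tableau) (b : nat * nat) :
  entry (append_first_row z T) b =
  if b == (0, size (nth [::] T 0)) then z else entry T b.
Proof.
case: b => r c; rewrite /entry nth_append_first_row xpair_eqE /=.
case: eqP => [->|_] //=; rewrite nth_rcons.
by case: ltngtP => // lt; rewrite nth_default // ltnW.
Qed.

Lemma no_empty_row_append (z : nat) (T : tableau) :
  0 \notin shape T -> 0 \notin shape (append_first_row z T).
Proof.
by case: T => [|R T] //=; rewrite !inE !negb_or size_rcons => /andP[_ ->].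
Qed.

Lemma exchange_append (z : nat) (T : tableau) (b b' : nat * nat) :
    has_box T b -> has_box T b' ->
  exchange (append_first_row z T) b b' = append_first_row z (exchange T b b').
Proof.
move=> hb hb'; have shE := shape_exchange hb hb'.
have hba : has_box (append_first_row z T) b by rewrite has_box_append hb.
have hba' : has_box (append_first_row z T) b' by rewrite has_box_append hb'.
have szE : size (nth [::] (exchange T b b') 0) = size (nth [::] T 0).
  by rewrite -!nth_shape shE.
have off c : has_box T c -> (c == (0, size (nth [::] T 0))) = false.
  by apply: contraTF => /eqP ->; rewrite /has_box /= ltnn.
apply: tableau_ext => [|c _].
  rewrite shape_exchange //; apply: (@eq_from_nth _ 0) => [|r _].
    have := congr1 size shE; rewrite !size_map !size_set_nth; lia.
  rewrite !nth_shape !nth_append_first_row; case: eqP; rewrite ?size_rcons ?szE //.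
  by rewrite -!nth_shape shE.
rewrite entry_exchange !entry_append szE entry_exchange (off b) // (off b') //.
case: (c =P b') => [->|_]; first by rewrite off.
by case: (c =P b) => [->|_]; first rewrite off.
Qed.

Lemma slide_next_append (z : nat) (T : tableau) (b b' : nat * nat) :
    (forall c, has_box T c -> entry T c < z) -> slide_next T b = Some b' ->
  slide_next (append_first_row z T) b = Some b'.
Proof.
move=> lt_z; have nd : (down b == (0, size (nth [::] T 0))) = false by [].
rewrite /slide_next !has_box_append !entry_append nd orbF.
case: (right b =P _) => [-> | _]; rewrite ?orbF ?orbT //.
rewrite [has_box T (0, _)]/has_box /= ltnn.
by case hd: (has_box T (down b)); rewrite ?lt_z.
Qed.

(** Being larger than every other entry, z is never the smaller of two neighbours,
    so the path is unchanged; if it stops at the end of the first row of T, it makes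
    one more move, past z. *)
Lemma slides_append (z : nat) (T T' : tableau) (b : nat * nat) :
    (forall c, has_box T c -> entry T c < z) ->
    0 \notin shape T -> has_box T b -> slides T b T' ->
  slides (append_first_row z T) b (append_first_row z T').
Proof.
move=> lt_z T0 hb sl; move: T b T' T0 hb sl lt_z.
apply: slides_ind_box => [T b T0 hb nxt|T b b' T' _ hb nxt hb' _ IH] lt_z; last first.
  apply: (SlideStep (slide_next_append lt_z nxt)); rewrite exchange_append //.
  apply: IH => c; rewrite (eq_has_box (shape_exchange hb hb')) entry_exchange.
  by move=> hc; case: eqP => _; [|case: eqP => _]; exact: lt_z.
have [nd nr] := slide_next_None nxt; have sz := corner_col hb nr.
have T0z := no_empty_row_append z T0.
have nda : ~~ has_box (append_first_row z T) (down b).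
  by rewrite has_box_append (negPf nd).
have hba : has_box (append_first_row z T) b by rewrite has_box_append hb.
case b1: (b.1 == 0); last first.
  have nxta : slide_next (append_first_row z T) b = None.
    rewrite /slide_next (negPf nda) has_box_append (negPf nr).
    by rewrite xpair_eqE /= b1.
  suff <- : delete_corner (append_first_row z T) b
          = append_first_row z (delete_corner T b) by exact: SlideStop.
  apply: rows_ext => [||r]; first exact: no_empty_row_delete.
    exact/no_empty_row_append/no_empty_row_delete.
  rewrite nth_delete_corner // !nth_append_first_row b1 !nth_delete_corner //.
  by rewrite (eq_sym 0) b1; case: (r =P b.1) => [->|_]; rewrite ?b1.
have sz0 : size (nth [::] T 0) = b.2.+1 by rewrite -(eqP b1).
(* The slide stops in the first row: it goes on by exchanging x with z. *)
have rE : right b = (0, size (nth [::] T 0)) by rewrite sz0 -(eqP b1).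
have hra : has_box (append_first_row z T) (right b).
  by rewrite has_box_append rE eqxx orbT.
have nxta : slide_next (append_first_row z T) b = Some (right b).
  by rewrite /slide_next (negPf nda) hra.
apply: (SlideStep nxta).
have shE := shape_exchange hba hra.
set U := exchange _ _ _ in shE *.
have U0 : 0 \notin shape U by rewrite shE.
have hrU : has_box U (right b) by rewrite (eq_has_box shE).
have nxtU : slide_next U (right b) = None.
  rewrite /slide_next !(eq_has_box shE) !has_box_append.
  move: nd; rewrite /has_box !xpair_eqE /= (eqP b1) sz0 => nd.
  by rewrite !ifN //=; lia.
suff <- : delete_corner U (right b) = append_first_row z (delete_corner T b).
  exact: SlideStop.
apply: rows_ext => [||r]; first exact: no_empty_row_delete.
  exact/no_empty_row_append/no_empty_row_delete.
rewrite nth_delete_corner // nth_append_first_row !nth_delete_corner // (eqP b1).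
have rowU i : i != 0 -> nth [::] U i = nth [::] T i.
  move=> i0; rewrite /U /exchange !row_set_entry !nth_append_first_row /= (eqP b1).
  by rewrite !(negPf i0).
case: (r =P (right b).1) => [->|/eqP]; rewrite /= (eqP b1); last first.
  by move=> r0; rewrite rowU // (negPf r0).
set R := take b.2 (nth [::] T 0).
have szR : size R = b.2 by rewrite size_takel // sz0.
have rowE : nth [::] T 0 = rcons R (entry T b).
  by have := row_corner hb nr; rewrite (eqP b1).
rewrite /U /exchange !row_set_entry !nth_append_first_row /= (eqP b1) /=.
rewrite entry_append rE eqxx rowE.
apply: (@eq_from_nth _ 0).
  by rewrite size_takel ?size_set_nth !size_rcons szR; lia.
move=> i; rewrite size_takel; last by rewrite !size_set_nth !size_rcons szR; lia.
move=> lt_i; rewrite nth_take // !nth_set_nth /= !nth_set_nth /= !nth_rcons.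
rewrite !size_rcons szR.
case: (i =P b.2.+1) => [|_]; first by lia.
by case: (i =P b.2) => [->|]; rewrite ?ltnn ?eqxx //; case: ltngtP => //; lia.
Qed.

(** * Row insertion *)

Lemma rsk_insert_cons (x : nat) (R : seq nat) (T : tableau) :
  rsk_insert x (R :: T) =
  let p := find (fun y => x < y) R in
  if has (fun y => x < y) R then set_nth 0 R p x :: rsk_insert (nth 0 R p) T
  else rcons R x :: T.
Proof. by rewrite /= -has_find. Qed.

Lemma rsk_perm (x : nat) (T : tableau) :
  perm_eq (flatten (rsk_insert x T)) (x :: flatten T).
Proof.
elim: T x => [|R T IH] x //; rewrite rsk_insert_cons /=.
case: ifP => [bump|_] /=; apply/permP => /= a; last first.
  by rewrite -cats1 !count_cat /=; lia.
have := permP (IH (nth 0 R (find (fun y => x < y) R))) a => /= IHa.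
rewrite !count_cat IHa has_find in bump *.
by have := count_row_set_nth a x bump; lia.
Qed.

(** No monotonicity is involved: bumping preserves row lengths and the insertion ends
    by extending one row. *)
Lemma rsk_adds_box (x : nat) (T : tableau) :
  exists r, adds_box r (shape T) (shape (rsk_insert x T)).
Proof.
elim: T x => [|R T IH] x; first by exists 0 => [[|[]]].
rewrite rsk_insert_cons /=; case: ifP => [bump|_] /=; last first.
  by exists 0 => [[|i]] /=; rewrite ?addn0 // size_rcons addn1.
have [r add] := IH (nth 0 R (find (fun y => x < y) R)).
exists r.+1 => [[|i]] /=; last exact: add.
by rewrite size_set_nth addn0; move: bump; rewrite has_find; lia.
Qed.

Lemma rsk_no_empty_row (x : nat) (T : tableau) :
  0 \notin shape T -> 0 \notin shape (rsk_insert x T).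
Proof.
elim: T x => [|R T IH] x //; rewrite rsk_insert_cons /= !inE !negb_or.
case/andP=> R0 T0; case: ifP => bump /=; rewrite inE negb_or.
  by rewrite IH // size_set_nth andbT; lia.
by rewrite size_rcons.
Qed.

Lemma rsk_count_head (a : pred nat) (x : nat) (T : tableau) :
  count a (nth [::] T 0) <= (count a (nth [::] (rsk_insert x T) 0)).+1.
Proof.
case: T => [|R T] //; rewrite rsk_insert_cons /=; case: ifP => bump /=.
  rewrite has_find in bump; have := count_row_set_nth a x bump.
  by case: (a _); case: (a _); lia.
by rewrite -cats1 count_cat; lia.
Qed.

Lemma rsk_append (x z : nat) (T : tableau) :
    has (fun y => x < y) (nth [::] T 0) ->
  rsk_insert x (append_first_row z T) = append_first_row z (rsk_insert x T).
Proof.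
case: T => [|R T] // bump.
have -> : append_first_row z (R :: T) = rcons R z :: T by [].
rewrite !rsk_insert_cons has_rcons.
rewrite /= in bump *; rewrite bump orbT -cats1 find_cat bump /append_first_row /=.
rewrite has_find in bump; rewrite nth_cat bump cats1; congr (_ :: _).
by elim: R {T} (find _ _) bump => [|y R IH] [|p] //= /IH ->.
Qed.

(** * Stability and necessity *)

Lemma jdt_delete_spec (x : nat) (T : tableau) :
    0 \notin shape T -> x \in flatten T ->
  [/\ perm_eq (flatten T) (x :: flatten (jdt_delete x T)),
      0 \notin shape (jdt_delete x T),
      exists r, adds_box r (shape (jdt_delete x T)) (shape T)
    & forall a : pred nat, ~~ a x ->
        count a (nth [::] T 0) <= count a (nth [::] (jdt_delete x T) 0)].
Proof.
move=> T0 xT; have [hb eq_x] := positionP xT.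
have sl : slides T (position x T) (jdt_delete x T) by apply/jdt_delete_slides.
split; first by rewrite -{1}eq_x; exact: slides_perm sl.
- exact: slides_no_empty_row sl.
- exact: slides_adds_box sl.
by move=> a nax; apply: slides_count_head sl => //; rewrite eq_x.
Qed.

Lemma position_append (x z : nat) (T : tableau) :
  x \in flatten T -> x != z -> position x (append_first_row z T) = position x T.
Proof.
case: T => [|R T] //= xT xz; rewrite /position /append_first_row /=.
rewrite mem_rcons inE (negPf xz) /=; case: ifP => //= xR.
by rewrite -cats1 index_cat xR.
Qed.

Lemma jdt_delete_append (x z : nat) (T : tableau) :
    0 \notin shape T -> x \in flatten T -> all (gtn z) (flatten T) ->
  jdt_delete x (append_first_row z T) = append_first_row z (jdt_delete x T).
Proof.
move=> T0 xT /allP lt_z; have [hb _] := positionP xT.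
have flat_z : perm_eq (flatten (append_first_row z T)) (z :: flatten T).
  case: T {T0 xT lt_z hb} => [|R T] //=.
  by rewrite -cats1 -catA perm_catC /= perm_cons perm_catC.
have xz : x != z by have := lt_z _ xT; rewrite /= neq_ltn => ->.
apply/jdt_delete_slides; first by rewrite (perm_mem flat_z) inE xT orbT.
rewrite position_append //; apply: slides_append => //.
  by move=> c hc; apply: lt_z; apply/mem_tableauP; exists c.
exact/jdt_delete_slides.
Qed.

(** One full step of the process, from an integer index to the next. *)
Definition reinsert (x : nat) (T : tableau) : tableau := rsk_insert x (jdt_delete x T).

Lemma perm_reinsert (x : nat) (T : tableau) :
    0 \notin shape T -> x \in flatten T ->
  perm_eq (flatten (reinsert x T)) (flatten T).
Proof.
move=> T0 xT; have [perm _ _ _] := jdt_delete_spec T0 xT.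
by apply: perm_trans (rsk_perm _ _) _; rewrite perm_sym.
Qed.

Lemma reinsert_no_empty_row (x : nat) (T : tableau) :
  0 \notin shape T -> x \in flatten T -> 0 \notin shape (reinsert x T).
Proof.
by move=> T0 xT; have [_ ? _ _] := jdt_delete_spec T0 xT; exact: rsk_no_empty_row.
Qed.

(** Every insertion of the run replaces an entry of the first row. *)
Fixpoint bumping (T : tableau) (i : seq nat) : bool :=
  if i is x :: i' then
    has (fun y => x < y) (nth [::] (jdt_delete x T) 0) && bumping (reinsert x T) i'
  else true.

Lemma vacillating_fromE (T : tableau) (x : nat) (i : seq nat) :
  vacillating_from T (x :: i) =
  [:: shape (jdt_delete x T), shape (reinsert x T) & vacillating_from (reinsert x T) i].
Proof. by []. Qed.

Lemma star_shape_append (z : nat) (T : tableau) :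
  star (shape (append_first_row z T)) = star (shape T).
Proof. by case: T. Qed.

Lemma subset_reinsert (x : nat) (i : seq nat) (T : tableau) :
    0 \notin shape T -> {subset x :: i <= flatten T} ->
  x \in flatten T /\ {subset i <= flatten (reinsert x T)}.
Proof.
move=> T0 sub; have xT : x \in flatten T by apply: sub; rewrite mem_head.
split=> // y yi; rewrite (perm_mem (perm_reinsert T0 xT)).
by apply: sub; rewrite inE yi orbT.
Qed.

Lemma vacillating_from_append (z : nat) (T : tableau) (i : seq nat) :
    0 \notin shape T -> {subset i <= flatten T} -> all (gtn z) (flatten T) ->
    bumping T i ->
  bumping (append_first_row z T) i /\
  map star (vacillating_from (append_first_row z T) i)
  = map star (vacillating_from T i).
Proof.
elim: i T => [|x i IH] T T0 sub lt_z //= /andP[bump bumps].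
have [xT sub'] := subset_reinsert T0 sub.
have jdtE := jdt_delete_append T0 xT lt_z.
have stepE : reinsert x (append_first_row z T) = append_first_row z (reinsert x T).
  by rewrite /reinsert jdtE rsk_append.
have [|bz vz] := IH _ (reinsert_no_empty_row T0 xT) sub' _ bumps.
  by rewrite (perm_all _ (perm_reinsert T0 xT)).
have sE U : star (Defs.shape (append_first_row z U)) = star (Defs.shape U).
  exact: star_shape_append.
rewrite -!/(reinsert x _) stepE jdtE bz vz !sE; split=> //.
by rewrite nth_append_first_row /= has_rcons bump orbT.
Qed.

(** Each step removes at most one entry > n from the first row: the slide of x <= n
    none, the insertion at most the one it bumps. So the count lasts for size i
    steps, and an entry > n in the first row exceeds x. *)
Lemma bumping_of_count (n : nat) (T : tableau) (i : seq nat) :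
    0 \notin shape T -> {subset i <= flatten T} -> {in i, forall x, x <= n} ->
    size i <= count (fun y => n < y) (nth [::] T 0) ->
  bumping T i.
Proof.
elim: i T => [|x i IH] T T0 sub le_n //= lt_i.
have [xT sub'] := subset_reinsert T0 sub.
have le_x : x <= n by apply: le_n; rewrite mem_head.
have [_ _ _ /(_ (fun y => n < y))] := jdt_delete_spec T0 xT.
rewrite -leqNgt => /(_ le_x) le_count; apply/andP; split.
  have : has (fun y => n < y) (nth [::] (jdt_delete x T) 0) by rewrite has_count; lia.
  by apply: sub_has => y; exact: leq_ltn_trans.
apply: IH => //; first exact: reinsert_no_empty_row.
  by move=> y yi; apply: le_n; rewrite inE yi orbT.
have := rsk_count_head (fun y => n < y) x (jdt_delete x T).
by rewrite -/(reinsert x T); lia.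
Qed.

Definition vacillating_step (la la' la'' : seq nat) : Prop :=
  (part_included la' la /\ (skew_size la la' = 0 \/ skew_size la la' = 1)) /\
  (part_included la' la'' /\ skew_size la'' la' = 1).

Lemma adds_box_star (r : nat) (mu la : seq nat) :
  adds_box r.+1 mu la -> adds_box r (star mu) (star la).
Proof. by move=> add i; rewrite !nth_behead add. Qed.

Lemma reinsert_vacillating (x : nat) (T : tableau) :
    0 \notin shape T -> x \in flatten T ->
    has (fun y => x < y) (nth [::] (jdt_delete x T) 0) ->
  vacillating_step (star (shape T)) (star (shape (jdt_delete x T)))
    (star (shape (reinsert x T))).
Proof.
move=> T0 xT bump; have [_ _ [r add] _] := jdt_delete_spec T0 xT; split.
  case: r add => [|r] add; last first.
    by have [? ?] := adds_box_skew_size (adds_box_star add); auto.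
  have [|? ?] := @skew_size_same (star (shape (jdt_delete x T))) (star (shape T)).
    by move=> i; rewrite !nth_behead add addn0.
  by auto.
rewrite /reinsert; case: (jdt_delete x T) bump => [|R U] //= bump.
rewrite -has_find bump /=.
have [r' add'] := rsk_adds_box (nth 0 R (find (fun y => x < y) R)) U.
exact: adds_box_skew_size add'.
Qed.

Lemma vacillating_from_steps (T : tableau) (i : seq nat) :
    0 \notin shape T -> {subset i <= flatten T} -> bumping T i ->
  forall j, j < size i ->
    let P := map star (shape T :: vacillating_from T i) in
    vacillating_step (nth [::] P j.*2) (nth [::] P j.*2.+1) (nth [::] P j.*2.+2).
Proof.
elim: i T => [|x i IH] T T0 sub //= /andP[bump bumps] [|j] lt_j.
  by case: (subset_reinsert T0 sub) => xT _; exact: reinsert_vacillating.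
have [xT sub'] := subset_reinsert T0 sub.
have := IH _ (reinsert_no_empty_row T0 xT) sub' bumps j lt_j.
by rewrite doubleS.
Qed.

Lemma vacillating_tableauE (m : nat) (i : seq nat) :
  vacillating_tableau m i = shape [:: iota 1 m] :: vacillating_from [:: iota 1 m] i.
Proof. by []. Qed.

Lemma append_iota (m : nat) : append_first_row m.+1 [:: iota 1 m] = [:: iota 1 m.+1].
Proof. by rewrite -{2}addn1 iotaD /= cats1 add1n. Qed.

Lemma subset_iota (n m : nat) (i : seq nat) :
    {in i, forall x, 0 < x} -> {in i, forall x, x <= n} -> n <= m ->
  {subset i <= flatten [:: iota 1 m]}.
Proof.
move=> gt0 le_n le_nm x xi; rewrite /= cats0 mem_iota gt0 //=.
by rewrite add1n ltnS (leq_trans (le_n x xi)).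
Qed.

(** By induction on m', since the tableau for m' + 1 arises from the one for m' by
    appending m' + 1 to the first row. *)
Lemma vacillating_tableau_stable (m m' : nat) (i : seq nat) :
    {in i, forall x, 0 < x} -> {in i, forall x, x <= m} -> 0 < m -> m <= m' ->
    bumping [:: iota 1 m] i ->
  map star (vacillating_tableau m' i) = map star (vacillating_tableau m i).
Proof.
move=> gt0 le_m m_gt0 le_mm' bump.
suff [] : bumping [:: iota 1 m'] i /\
  map star (vacillating_tableau m' i) = map star (vacillating_tableau m i) by [].
elim: m' le_mm' => [|m' IH]; first by rewrite leqn0 => /eqP m0; rewrite m0 in m_gt0.
rewrite leq_eqVlt => /predU1P[<-|] //; rewrite ltnS => le_mm'.
have [bump' <-] := IH le_mm'; rewrite !vacillating_tableauE -append_iota /=.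
have [||||-> ->] // := @vacillating_from_append m'.+1 [:: iota 1 m'] i.
- by rewrite /= inE size_iota; lia.
- exact: (subset_iota gt0 le_m).
by apply/allP=> y; rewrite /= cats0 mem_iota; lia.
Qed.

Lemma bumping_iota (n m : nat) (i : seq nat) :
    {in i, forall x, 0 < x} -> {in i, forall x, x <= n} -> n + size i < m ->
  bumping [:: iota 1 m] i.
Proof.
move=> gt0 le_n lt_m; apply: (@bumping_of_count n) => //.
- by rewrite /= inE size_iota; lia.
- by apply: (subset_iota gt0 le_n); lia.
rewrite /= -(subnKC (_ : n <= m)); last lia.
rewrite iotaD count_cat (_ : count _ (iota (1 + n) _) = m - n); first lia.
rewrite -[RHS](size_iota (1 + n)); apply/eqP; rewrite -all_count.
by apply/allP => y; rewrite mem_iota; lia.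
Qed.

(** * Standard tableaux *)

(** The strict order on boxes with respect to which entries increase. *)
Definition before (a b : nat * nat) : bool :=
  [&& a.1 <= b.1, a.2 <= b.2 & a != b].

(** The existence of a box at every earlier position says that the shape is a
    partition diagram. *)
Definition standard (T : tableau) : Prop :=
  0 \notin shape T /\
  forall a b, has_box T b -> before a b -> has_box T a /\ entry T a < entry T b.

Lemma standard_cons (R : seq nat) (T : tableau) :
  standard (R :: T) <->
  [/\ 0 < size R, standard T, size (nth [::] T 0) <= size R,
      forall i j, i < j < size R -> nth 0 R i < nth 0 R j
    & forall j, j < size (nth [::] T 0) -> nth 0 R j < nth 0 (nth [::] T 0) j].
Proof.
split=> [[RT0 std]|[R0 [T0 std] le_size row col]].
  move: RT0; rewrite /= inE negb_or => /andP[R0 T0].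
  have std1 a b : has_box (R :: T) b -> before a b ->
    has_box (R :: T) a /\ entry (R :: T) a < entry (R :: T) b by exact: std.
  split.
  - by rewrite lt0n eq_sym.
  - split=> // [[r c] [r' c']] hb; rewrite /before xpair_eqE /= => lt.
    by apply: (std1 (r.+1, c) (r'.+1, c')); rewrite // /before xpair_eqE.
  - rewrite leqNgt; apply/negP => lt.
    have [] := std1 (0, size R) (1, size R); rewrite // /before ?xpair_eqE /= ?leqnn //.
    by rewrite /has_box /= ltnn.
  - move=> i j /andP[lt_ij lt_j].
    have [] // := std1 (0, i) (0, j); rewrite /before xpair_eqE /=; lia.
  - move=> j lt_j.
    by have [] // := std1 (0, j) (1, j); rewrite /before xpair_eqE /=; lia.
split=> [|[[|r] c] [[|r'] c'] //]; first by rewrite /= inE negb_or T0 eq_sym -lt0n R0.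
- rewrite /before xpair_eqE /= => hb lt; split; last first.
    by apply: row; move: hb; rewrite /has_box /=; lia.
  by move: hb; rewrite /has_box /=; lia.
- rewrite /before xpair_eqE /= => hb lt.
  have hb0 : has_box T (0, c').
    case: r' hb {lt} => [|r'] hb //; have [] // := std (0, c') (r'.+1, c') hb.
    by rewrite /before xpair_eqE /=; lia.
  have hc : c' < size (nth [::] T 0) by [].
  have le0 : entry T (0, c') <= entry T (r', c').
    case: r' hb {lt} => [|r'] hb //; apply: ltnW.
    by have [] // := std (0, c') (r'.+1, c') hb; rewrite /before xpair_eqE /=; lia.
  split; first by rewrite /has_box /=; lia.
  apply: leq_trans (_ : _ < entry T (0, c')) le0.
  apply: leq_ltn_trans (_ : nth 0 R c <= nth 0 R c') (col _ hc).
  have : c <= c' by lia.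
  by rewrite leq_eqVlt => /predU1P[->|lt_c] //; apply/ltnW/row; lia.
rewrite /before xpair_eqE /= => hb lt.
by apply: (std (r, c) (r', c')) => //; rewrite /before xpair_eqE.
Qed.

Lemma standard_nil : standard [::].
Proof. by split=> // a [r c]; rewrite /has_box nth_nil. Qed.

(** * Undoing a row insertion *)

Lemma rsk_insert_end (x : nat) (R : seq nat) (T : tableau) :
    (forall j, j < size R -> nth 0 R j <= x) ->
  rsk_insert x (R :: T) = rcons R x :: T.
Proof.
move=> le_x; rewrite rsk_insert_cons /= ifN //; apply/hasPn => y yR.
by rewrite -leqNgt -(nth_index 0 yR) le_x ?index_mem.
Qed.

Lemma rsk_reverse_row (x y p : nat) (R : seq nat) (T : tableau) :
    (forall i j, i < j < size R -> nth 0 R i < nth 0 R j) ->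
    p < size R -> nth 0 R p = x -> x < y ->
  rsk_insert x (set_nth 0 R p y :: T) = R :: rsk_insert y T.
Proof.
move=> row lt_p eq_x lt_xy.
have sz : size (set_nth 0 R p y) = size R by rewrite size_set_nth; lia.
have findE : find (fun z => x < z) (set_nth 0 R p y) = p.
  have hasp : has (fun z => x < z) (set_nth 0 R p y).
    by apply/(has_nthP 0); exists p; rewrite ?sz // nth_set_nth /= eqxx.
  have := nth_find 0 hasp; set q := find _ _ => lt_q.
  case: (ltngtP q p) => // [lt_qp|lt_pq].
    move: lt_q; rewrite nth_set_nth /= ifN; last by lia.
    by rewrite -eq_x ltnNge ltnW // row // lt_qp.
  by have := before_find 0 lt_pq; rewrite nth_set_nth /= eqxx lt_xy.
rewrite rsk_insert_cons /= has_find findE sz lt_p nth_set_nth /= eqxx.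
congr (_ :: _); apply: (@eq_from_nth _ 0); rewrite !size_set_nth; first lia.
by move=> j _; rewrite !nth_set_nth /= !nth_set_nth /=; case: eqP => // ->.
Qed.

Lemma adds_box_behead (r a b : nat) (mu la : seq nat) :
  adds_box r.+1 (b :: mu) (a :: la) -> a = b /\ adds_box r mu la.
Proof.
move=> add; split=> [|i]; last exact: (add i.+1).
by rewrite -[b]addn0; exact: (add 0).
Qed.

Lemma is_part_behead (la : seq nat) : is_part la -> is_part (behead la).
Proof.
case: la => //= a la /andP[/= srt]; rewrite inE negb_or => /andP[_ nla].
by rewrite /is_part nla (path_sorted srt).
Qed.

Lemma is_part_no0 (la : seq nat) : is_part la -> 0 \notin la.
Proof. by case/andP. Qed.

(** Reverse bumping: if y comes out of the rows below the first row R, it takes the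
    place of the largest entry x of R smaller than y, and x comes out. The last clause
    records what the recursion needs to see columns increase: the entries of the
    first row can only have grown, and those from the column of the extracted entry
    onwards exceed it. *)
Lemma rsk_reverse (r : nat) (T : tableau) (mu : seq nat) :
    standard T -> uniq (flatten T) -> is_part mu -> adds_box r mu (shape T) ->
  exists x U, [/\ standard U, shape U = mu & rsk_insert x U = T] /\
    exists c, [/\ c < size (nth [::] T 0), entry T (0, c) = x &
      forall j, j < size (nth [::] U 0) ->
        entry T (0, j) <= entry U (0, j) /\ (c <= j -> x < entry U (0, j))].
Proof.
elim: r T mu => [|r IH] [|R T] mu stdT uT pmu add.
- by have := add 0; rewrite /=; lia.
- have [R0 stT le_size row col] := proj1 (standard_cons R T) stdT.
  case: mu pmu add => [|m mu] pmu add.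
    have T_nil : T = [::].
      apply/eqP; rewrite -size_eq0 -leqn0 leqNgt; apply/negP => lt.
      have [T0 _] := stT; have := row_gt0 0 T0; rewrite lt -nth_shape.
      by have := add 1; rewrite /= => ->.
    have szR : size R = 1 by have := add 0.
    case: R szR {stdT uT add R0 le_size row col} => [|x []] // _.
    exists x, [::]; split; first by split=> //; [exact: standard_nil | rewrite T_nil].
    by exists 0.
  have szR : size R = m.+1 by have := add 0; rewrite /= addn1.
  case/lastP: R szR stdT uT add R0 le_size row col => // R x.
  rewrite size_rcons => -[szR] stdT uT add _ le_size row col.
  have shT : shape T = mu.
    apply: part_ext => [||i]; first by case: stT.
      by have := is_part_no0 pmu; rewrite inE negb_or => /andP[].
    by have := add i.+1; rewrite /= addn0.
  have szT : size (nth [::] T 0) <= size R.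
    by rewrite -nth_shape shT szR; have := is_part_nth_geq pmu (leqnSn 0).
  have nthR j : j < size R -> nth 0 (rcons R x) j = nth 0 R j.
    by move=> lt; rewrite nth_rcons lt.
  exists x, (R :: T); split; first split.
  + apply/standard_cons; split=> //.
    * rewrite szR; exact: (is_part_nth_gt0 pmu (i := 0)).
    * move=> i j lt; rewrite -!nthR; try lia; apply: row; rewrite ?size_rcons; lia.
    * by move=> j lt; rewrite -nthR; [exact: col | lia].
  + by rewrite /= szR shT.
  + apply: rsk_insert_end => j lt; rewrite -nthR // ltnW //.
    have xE : nth 0 (rcons R x) (size R) = x by rewrite nth_rcons ltnn eqxx.
    by rewrite -[X in _ < X]xE; apply: row; lia.
  exists (size R); split; rewrite /entry /= ?size_rcons ?nth_rcons ?ltnn ?eqxx //.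
  by move=> j /= lt; rewrite nthR // leqnn; split=> //; lia.
- by have := add r.+1; rewrite /= eqxx; lia.
have [R0 stT le_size row col] := proj1 (standard_cons R T) stdT.
case: mu pmu add => [|m mu] pmu add.
  by have := add 0; move: R0; rewrite /=; lia.
have [szR addT] : size R = m /\ adds_box r mu (shape T) := adds_box_behead add.
have pmu' : is_part mu := is_part_behead pmu.
have uT' : uniq (flatten T) by move: uT; rewrite /= cat_uniq => /and3P[].
have [y [U [[stU shU rskU] [c [lt_c eq_y UT]]]]] := IH T mu stT uT' pmu' addT.
have yR : y \notin R.
  move: uT; rewrite /= cat_uniq => /and3P[_ /hasPn disj _]; apply: disj.
  by apply/mem_tableauP; exists (0, c).
have lt_cR : c < size R by exact: leq_trans lt_c le_size.
have lt_cy : nth 0 R c < y by rewrite -eq_y; exact: col.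
(* The entries of R smaller than y are those in columns < q; column c is one of
   them, so p = q - 1 is well defined and p >= c. *)
pose q := find (fun z => y < z) R.
have lt_q j : j < q -> nth 0 R j < y.
  move=> ltj; have := before_find 0 ltj; rewrite ltnNge => /negbFE.
  rewrite leq_eqVlt => /predU1P[eq_jy|] //; case/negP: yR; rewrite -eq_jy mem_nth //.
  by apply: leq_trans ltj _; exact: find_size.
have ge_q j : q <= j < size R -> y < nth 0 R j.
  case/andP=> le_qj lt_j; have hasq : has (fun z => y < z) R.
    by rewrite has_find; exact: leq_ltn_trans le_qj lt_j.
  have lt_yq := nth_find 0 hasq; move: le_qj; rewrite leq_eqVlt => /predU1P[<-//|lt_qj].
  by apply: (ltn_trans lt_yq); apply: row; rewrite lt_qj.
have lt_cq : c < q.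
  by rewrite ltnNge; apply/negP => le; have := ge_q c; rewrite le lt_cR => /(_ isT); lia.
have le_qR : q <= size R by exact: find_size.
have [p qE] : exists p, q = p.+1 by exists q.-1; lia.
have lt_p : p < size R by lia.
have lt_py : nth 0 R p < y by apply: lt_q; lia.
pose R' := set_nth 0 R p y.
have szR' : size R' = size R by rewrite size_set_nth; lia.
have nthR' j : nth 0 R' j = if j == p then y else nth 0 R j by rewrite nth_set_nth.
exists (nth 0 R p), (R' :: U); split; first split.
- apply/standard_cons; rewrite szR'; split=> //.
  + rewrite -nth_shape shU szR; exact: (is_part_nth_geq pmu (leqnSn 0)).
  + move=> i j /andP[lt_ij lt_j]; rewrite !nthR'.
    case: (i =P p) => [ip|_]; first by rewrite ifN; [apply: ge_q; lia | lia].
    case: (j =P p) => [jp|_]; last by apply: row; rewrite lt_ij.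
    by apply: lt_q; lia.
  + move=> j lt_j; have [le_TU lt_y] := UT j lt_j; rewrite nthR'.
    case: (j =P p) => [jp|_]; first by apply: lt_y; lia.
    apply: leq_trans le_TU; apply: col.
    by move: lt_j; rewrite -!nth_shape shU addT; lia.
- by rewrite /= szR' szR shU.
- by rewrite rsk_reverse_row // rskU.
exists p; split=> //= j; rewrite szR' => lt_j; rewrite /entry /= nthR'.
case: (j =P p) => [->|/eqP jp]; first by rewrite ltnW.
by split=> // le_pj; apply: row; rewrite lt_j ltn_neqAle eq_sym jp le_pj.
Qed.

(** * Undoing a slide *)

(** T is standard up to the entry in box p, which may be too small compared to the
    entries before it. This is the state of a slide in progress seen backwards. *)
Definition standard_except (p : nat * nat) (T : tableau) : Prop :=
  [/\ 0 \notin shape T,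
      forall a b, has_box T b -> before a b -> has_box T a,
      forall a b, has_box T b -> before a b -> a != p -> b != p ->
        entry T a < entry T b
    & forall b, has_box T b -> before p b -> entry T p < entry T b].

Lemma before_trans (a b c : nat * nat) : before a b -> before b c -> before a c.
Proof. by case: a b c => [? ?] [? ?] [? ?]; rewrite /before !xpair_eqE /=; lia. Qed.

Lemma before_down (b : nat * nat) : before b (down b).
Proof. by case: b => i j; rewrite /before /down xpair_eqE /=; lia. Qed.

Lemma before_right (b : nat * nat) : before b (right b).
Proof. by case: b => i j; rewrite /before /right xpair_eqE /=; lia. Qed.

(** After moving the entry of p back to q, the slide from q returns to p, because the
    entry now in p is smaller than the other neighbour of q. *)
Lemma slide_next_exchange (T : tableau) (p q : nat * nat) :
    has_box T p -> has_box T q -> p = down q \/ p = right q ->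
    (forall b, has_box T b -> before q b -> b != p -> entry T q < entry T b) ->
  slide_next (exchange T q p) q = Some p.
Proof.
move=> hp hq adj lt_q; have shE := shape_exchange hq hp.
have neq_dr : down q != right q by rewrite /down /right xpair_eqE /=; lia.
have qd : before q (down q) by exact: before_down.
have qr : before q (right q) by exact: before_right.
have nd : (down q == q) = false by case/and3P: qd => _ _; rewrite eq_sym => /negPf.
have nr : (right q == q) = false by case/and3P: qr => _ _; rewrite eq_sym => /negPf.
rewrite /slide_next !(eq_has_box shE) !entry_exchange.
case: adj => eq_p; rewrite eq_p in hp lt_q *; rewrite hp eqxx ?nd ?nr.
  rewrite eq_sym (negPf neq_dr); case hr: (has_box T (right q)) => //.
  by rewrite lt_q // eq_sym.
rewrite (negPf neq_dr); case hd: (has_box T (down q)) => //.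
by rewrite ifN // -leqNgt ltnW // lt_q.
Qed.

Lemma seq_argmax (I : eqType) (f : I -> nat) (s : seq I) :
  s != [::] -> exists2 x, x \in s & forall y, y \in s -> f y <= f x.
Proof.
elim: s => [|x [|y s] IH] //= _.
  by exists x => [|z]; rewrite inE // => /eqP->.
have [//|z zs max_z] := IH; case: (leqP (f x) (f z)) => [le|lt].
  by exists z => [|t]; rewrite inE ?zs ?orbT // => /predU1P[->|/max_z].
exists x => [|t]; rewrite inE ?eqxx // => /predU1P[->|/max_z] // /leq_trans->//.
exact: ltnW.
Qed.

(** When the entry of p exceeds everything before it, nothing remains to be
    corrected and the reverse slide stops. *)
Lemma standard_except_end (p : nat * nat) (T : tableau) :
    standard_except p T -> (forall a, before a p -> entry T a < entry T p) ->
  standard T.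
Proof.
case=> T0 clo inc inc_p lt_p; split=> // a b hb ab; split; first exact: clo ab.
case: (b =P p) ab hb => [->|/eqP nb] ab hb; first exact: lt_p.
case: (a =P p) ab => [->|/eqP na] ab; [exact: inc_p | exact: inc].
Qed.

(** Take q with the largest entry among the boxes before p. A box strictly between q
    and p would have a larger entry, so q is adjacent to p, and it is the larger of
    the upper and left neighbours. Moving the entry of p there restores the order
    around p, and the slide from q starts by undoing this move. *)
Lemma slides_back (T T' : tableau) (p : nat * nat) (a : nat * nat) :
    uniq (flatten T) -> has_box T p -> standard_except p T -> slides T p T' ->
    before a p -> entry T p < entry T a ->
  exists q, [/\ q.1 + q.2 < p.1 + p.2, has_box T q,
                standard_except q (exchange T q p) & slides (exchange T q p) q T'].
Proof.
move=> uT hp [T0 clo inc inc_p] sl ap lt_pa.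
pose s := [seq b <- diagram (shape T) | before b p].
have mem_s b : (b \in s) = before b p.
  rewrite mem_filter mem_diagram -has_box_shape andb_idr //; exact: clo.
have [|q] := @seq_argmax _ (entry T) s.
  by apply: contraL (ap) => /eqP s0; rewrite -mem_s s0.
rewrite mem_s => qp max_q; have hq := clo _ _ hp qp.
have npq : q != p by case/and3P: qp.
have lt_pq : entry T p < entry T q.
  by apply: leq_trans lt_pa _; apply: max_q; rewrite mem_s.
have nbefore b : before q b -> before b p -> False.
  move=> qb bp; have nbp : b != p by case/and3P: bp.
  by have := inc _ _ (clo _ _ hp bp) qb npq nbp; rewrite ltnNge max_q ?mem_s.
have adj : p = down q \/ p = right q.
  case: q p {hp inc inc_p sl ap lt_pa s mem_s hq npq lt_pq max_q clo} qp nbefore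
    => [i j] [i' j'].
  rewrite /before /down /right !xpair_eqE /= => qp nbefore.
  case: (ltnP i i') => [lt_i|le_i].
    have := nbefore (i'.-1, j'); rewrite !xpair_eqE /= => nb; left.
    by congr (_, _); lia.
  have := nbefore (i', j'.-1); rewrite !xpair_eqE /= => nb; right.
  by congr (_, _); lia.
have shE := shape_exchange hq hp.
have lt_q b : has_box T b -> before q b -> b != p -> entry T q < entry T b.
  by move=> hb qb nbp; apply: inc.
exists q; split=> //.
- by case: adj => -> /=; lia.
- split=> [|c b|c b|b]; first (by rewrite shE); rewrite (eq_has_box shE) => hb.
  + by rewrite (eq_has_box shE); exact: clo.
  + rewrite !entry_exchange => cb ncq nbq; rewrite (negPf ncq) (negPf nbq).
    case: (c =P p) => [cp|/eqP ncp]; case: (b =P p) => [bp|/eqP nbp].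
    * by move: cb; rewrite cp bp /before eqxx !andbF.
    * by apply: lt_q => //; apply: before_trans qp _; rewrite -cp.
    * have hc := clo _ _ hb cb; rewrite bp in cb.
      rewrite ltn_neqAle max_q ?mem_s // andbT.
      by apply: contraNneq ncq => eq_e; apply/eqP/(uniq_entry_inj uT).
    * exact: inc.
  move=> qb; rewrite !entry_exchange (negPf npq) eqxx.
  case: (b =P p) => [//|/eqP nbp].
  rewrite ifN; last by case/and3P: qb => _ _; rewrite eq_sym.
  exact: ltn_trans lt_pq (lt_q _ hb qb nbp).
apply: (@SlideStep _ _ p); first exact: slide_next_exchange.
suff -> : exchange (exchange T q p) q p = T by [].
apply: tableau_ext; first by rewrite shape_exchange ?(eq_has_box shE).
move=> b _; rewrite !entry_exchange !eqxx (negPf npq).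
by case: (b =P p) => [->|_] //; case: (b =P q) => [->|].
Qed.

Lemma standard_of_slides (n : nat) (T T' : tableau) (p : nat * nat) :
    p.1 + p.2 < n -> uniq (flatten T) -> has_box T p -> standard_except p T ->
    slides T p T' ->
  exists U q, [/\ standard U, shape U = shape T, has_box U q,
    entry U q = entry T p & slides U q T'].
Proof.
elim: n T p => // n IH T p lt_n uT hp exc sl.
have [T0 clo _ _] := exc.
pose ordered a := before a p ==> (entry T a < entry T p).
case: (boolP (all ordered (diagram (shape T)))).
  move=> /allP lt_p; exists T, p; split=> //; apply: (standard_except_end exc) => a ap.
  have := lt_p a; rewrite /ordered mem_diagram -has_box_shape ap /=.
  by apply; exact: clo ap.
case/allPn => a; rewrite /ordered mem_diagram -has_box_shape negb_imply -leqNgt.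
move=> ha /andP[ap le_pa].
have lt_pa : entry T p < entry T a.
  rewrite ltn_neqAle le_pa andbT; apply/negP => /eqP/(uniq_entry_inj uT hp ha) pa.
  by rewrite pa /before eqxx !andbF in ap.
have [q [lt_q hq exc' sl']] := slides_back uT hp exc sl ap lt_pa.
have shE := shape_exchange hq hp.
have lt_n' : q.1 + q.2 < n by lia.
have uT' : uniq (flatten (exchange T q p)) by rewrite (perm_uniq (perm_exchange hq hp)).
have hq' : has_box (exchange T q p) q by rewrite (eq_has_box shE).
have [U [r [stU shU hr eU slU]]] := IH _ q lt_n' uT' hq' exc' sl'.
exists U, r; rewrite shU shE eU entry_exchange eqxx; split=> //.
by case: (q =P p) => [->|].
Qed.

Lemma standard_no_empty (T : tableau) : standard T -> 0 \notin shape T.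
Proof. by case. Qed.

(** Put x in the new corner, where the slide would end, and run the slide backwards
    until the tableau is standard. *)
Lemma jdt_reverse (r x : nat) (T' : tableau) (la : seq nat) :
    standard T' -> uniq (x :: flatten T') -> is_part la ->
    adds_box r (shape T') la ->
  exists T, [/\ standard T, shape T = la, x \in flatten T & jdt_delete x T = T'].
Proof.
move=> [T'0 std] uT' pla add; pose c := size (nth [::] T' r); pose p := (r, c).
have la_r : nth 0 la r = c.+1 by rewrite add eqxx nth_shape addn1.
pose T := set_entry T' p x.
have rowT i : nth [::] T i =
    if i == r then rcons (nth [::] T' r) x else nth [::] T' i.
  rewrite row_set_entry /=; case: eqP => // _.
  by rewrite /c; elim: (nth [::] T' r) => //= y R ->.
have sizeT i : size (nth [::] T i) = nth 0 la i.
  rewrite rowT add nth_shape; case: eqP => [->|_]; rewrite ?addn0 //.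
  by rewrite size_rcons addn1.
have hbT b : has_box T b = (b.2 < nth 0 la b.1) by rewrite /has_box sizeT.
have T0 : 0 \notin shape T.
  apply/negP => /(nthP 0)[i]; rewrite size_map => lt_i; rewrite nth_shape sizeT => la_i0.
  have le_i : size la <= i.
    by rewrite leqNgt; apply/negP => /(is_part_nth_gt0 pla); rewrite la_i0.
  have lt_r : r < size la by case: ltnP la_r => // /(nth_default 0) ->.
  have : i < size T' \/ i = r.
    by move: lt_i; rewrite size_set_nth /=; lia.
  case=> [lt_iT'|]; last by lia.
  by have := add i; rewrite la_i0 nth_shape; have := row_gt0 i T'0; rewrite lt_iT'; lia.
have shT : shape T = la.
  by apply: part_ext => // [|i]; [exact: is_part_no0 | rewrite nth_shape sizeT].
have hp : has_box T p by rewrite hbT /= la_r.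
have entT b : b != p -> entry T b = entry T' b.
  by rewrite entry_set_entry => /negPf ->.
have entp : entry T p = x by rewrite entry_set_entry eqxx.
have box' b : has_box T b -> b != p -> has_box T' b.
  case: b => i j; rewrite hbT add nth_shape /has_box /p xpair_eqE /=.
  by case: eqP => [->|_] /=; rewrite /c; lia.
have before_irr b : before b b = false by rewrite /before eqxx !andbF.
have after_p b : has_box T b -> ~~ before p b.
  move=> hb; apply/negP => pb; have [|b_p] := eqVneq b p.
    by move=> bp; rewrite bp before_irr in pb.
  have [hp' _] := std _ _ (box' _ hb b_p) pb.
  by move: hp'; rewrite /has_box /= ltnn.
have exc : standard_except p T.
  split=> // [a b|a b|b] hb; last by rewrite (negPf (after_p _ hb)).
    case: a b hb => [i j] [i' j']; rewrite !hbT /before /= => hb /and3P[le_i le_j _].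
    by have := is_part_nth_geq pla le_i; lia.
  move=> ab nap nbp; rewrite !entT //.
  by have [] := std _ _ (box' _ hb nbp) ab.
have nxt : slide_next T p = None.
  have off b : before p b -> has_box T b = false.
    by move=> pb; apply: contraTF pb; exact: after_p.
  rewrite /slide_next !off //.
    by rewrite /before /p xpair_eqE /=; lia.
  by rewrite /before /p xpair_eqE /=; lia.
have sl : slides T p T'.
  suff -> : T' = delete_corner T p by exact: SlideStop.
  apply: rows_ext => // [|i]; first exact: no_empty_row_delete.
  rewrite nth_delete_corner //= !rowT eqxx; case: eqP => // ->.
  by rewrite -cats1 take_size_cat.
have uT : uniq (flatten T).
  by rewrite (perm_uniq (slides_perm T0 hp sl)) entp.
have [U [q [stU shU hq eq_q slU]]] := standard_of_slides (ltnSn _) uT hp exc sl.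
have permU := slides_perm (standard_no_empty stU) hq slU; rewrite eq_q entp in permU.
have xU : x \in flatten U by rewrite (perm_mem permU) mem_head.
exists U; split=> //; first by rewrite shU.
have [hpos e_pos] := positionP xU.
apply/jdt_delete_slides => //; suff -> : position x U = q by [].
apply: (@uniq_entry_inj U) => //; last by rewrite e_pos eq_q.
by rewrite (perm_uniq permU).
Qed.

(** * Sufficiency *)

Fixpoint row_filling (s : nat) (la : seq nat) : tableau :=
  if la is l :: la' then iota s l :: row_filling (s + l) la' else [::].

Lemma flatten_row_filling (s : nat) (la : seq nat) :
  flatten (row_filling s la) = iota s (sumn la).
Proof. by elim: la s => [|l la IH] s //=; rewrite IH iotaD. Qed.

Lemma shape_row_filling (s : nat) (la : seq nat) : shape (row_filling s la) = la.
Proof. by elim: la s => [|l la IH] s //=; rewrite IH size_iota. Qed.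

Lemma standard_row_filling (s : nat) (la : seq nat) :
  is_part la -> standard (row_filling s la).
Proof.
elim: la s => [|l la IH] s pla; first exact: standard_nil.
have sz : nth 0 la 0 <= l := is_part_nth_geq pla (leqnSn 0).
apply/standard_cons; rewrite size_iota -nth_shape shape_row_filling; split=> //.
- exact: (is_part_nth_gt0 pla (i := 0)).
- exact/IH/(is_part_behead pla).
- by move=> i j lt; rewrite !nth_iota; lia.
case: la sz {pla IH} => [|l' la] //= sz j lt_j; rewrite !nth_iota; lia.
Qed.

(** The partition of n whose simplified version is la. *)
Definition pad (n : nat) (la : seq nat) : seq nat := n - sumn la :: la.

Lemma is_part_pad (n : nat) (la : seq nat) :
  is_part la -> (sumn la).*2 < n -> is_part (pad n la).
Proof.
rewrite /is_part => /andP[srt n0] lt_n; rewrite /= inE negb_or n0.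
case: la srt n0 lt_n => [|a la] /=; first by lia.
by move=> -> _; lia.
Qed.

Lemma adds_box_pad (n r : nat) (mu la : seq nat) :
  adds_box r mu la -> adds_box r.+1 (pad n mu) (pad n.+1 la).
Proof.
by move=> add [|i] /=; [rewrite (sumn_add_box add) subSS addn0 | exact: add].
Qed.

Lemma adds_box_pad_same (n : nat) (la : seq nat) :
  sumn la <= n -> adds_box 0 (pad n la) (pad n.+1 la).
Proof. by move=> le_n [|i] /=; [lia | rewrite addn0]. Qed.

Lemma deletion_pad (mu la : seq nat) (n : nat) :
    is_part la -> is_part mu -> part_included mu la ->
    skew_size la mu = 0 \/ skew_size la mu = 1 -> sumn mu <= n ->
  exists r, adds_box r (pad n mu) (pad n.+1 la).
Proof.
move=> pla pmu sub [sk|sk] le_n.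
  have -> : la = mu by apply: part_ext (same_of_skew_size sub sk); exact: is_part_no0.
  by exists 0; exact: adds_box_pad_same.
have [r add] := adds_box_of_skew_size sub sk.
by exists r.+1; exact: adds_box_pad.
Qed.

(** The insertion undone here bumps in the first row: otherwise it would lengthen that
    row, whereas the box it adds belongs to la''. *)
Lemma reinsert_reverse (n : nat) (la la' la'' : seq nat) (T2 : tableau) :
    is_part la -> is_part la' -> (sumn la).*2 < n.+1 -> (sumn la').*2 < n ->
    vacillating_step la la' la'' ->
    standard T2 -> uniq (flatten T2) -> shape T2 = pad n.+1 la'' ->
  exists T x, [/\ standard T, shape T = pad n.+1 la, x \in flatten T,
    has (fun y => x < y) (nth [::] (jdt_delete x T) 0) /\
    shape (jdt_delete x T) = pad n la' & reinsert x T = T2].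
Proof.
move=> pla pla' lt_la lt_la' [[sub sk] [sub' sk']] std2 u2 sh2.
have [r add] := adds_box_of_skew_size sub' sk'.
have add2 : adds_box r.+1 (pad n la') (shape T2) by rewrite sh2; exact: adds_box_pad.
have pad' := is_part_pad pla' lt_la'.
have [x [T1 [[std1 sh1 rsk1] _]]] := rsk_reverse std2 u2 pad' add2.
have u1 : uniq (x :: flatten T1) by rewrite -(perm_uniq (rsk_perm x T1)) rsk1.
have le_n : sumn la' <= n by lia.
have [r' add1] := deletion_pad pla pla' sub sk le_n.
rewrite -sh1 in add1.
have [T [std sh xT jdtT]] := jdt_reverse std1 u1 (is_part_pad pla lt_la) add1.
exists T, x; rewrite /reinsert jdtT; split=> //; split=> //.
case: T1 {std1 u1 add1 jdtT} sh1 rsk1 => [|R T1] // [szR _].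
rewrite rsk_insert_cons /=; case: ifP => // _ eq_T2.
move: sh2; rewrite -eq_T2 => -[]; rewrite size_rcons szR (sumn_add_box add); lia.
Qed.

(** Built from the end of P. The bound on n makes every padded sequence a partition,
    also at the half-integer indices where the size is n instead of n + 1. *)
Lemma vacillating_realize (n k : nat) (P : seq (seq nat)) :
    size P = k.*2.+1 -> all is_part P -> all (fun la => (sumn la).*2 < n) P ->
    (forall j, j < k ->
       vacillating_step (nth [::] P j.*2) (nth [::] P j.*2.+1) (nth [::] P j.*2.+2)) ->
  exists T i, [/\ standard T, shape T = pad n.+1 (nth [::] P 0),
    perm_eq (flatten T) (iota 1 n.+1), bumping T i &
    [/\ size i = k, {subset i <= iota 1 n.+1} &
        map star (shape T :: vacillating_from T i) = P]].
Proof.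
elim: k P => [|k IH] P.
  case: P => [|la []] //= _ /andP[pla _] /andP[lt_la _] _.
  have pp : is_part (pad n.+1 la) by apply: is_part_pad => //; lia.
  exists (row_filling 1 (pad n.+1 la)), [::].
  rewrite shape_row_filling flatten_row_filling; split=> //.
    exact: standard_row_filling.
  by rewrite /= subnK //; lia.
case: P => [|la [|la' [|la'' P]]] // [szP].
move=> /and3P[pla pla' pP] /and3P[lt_la lt_la' lt_P] steps.
have [||T2 [i [std2 sh2 perm2 bump2 [szi subi eqP]]]] := IH (la'' :: P) _ pP lt_P.
- by rewrite /= szP.
- by move=> j lt_j; exact: (steps j.+1).
have u2 : uniq (flatten T2) by rewrite (perm_uniq perm2) iota_uniq.
have [|T [x [std sh xT [bump sh1] stepE]]] :=
  reinsert_reverse pla pla' _ lt_la' (steps 0 isT) std2 u2 sh2; first lia.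
have permT : perm_eq (flatten T) (iota 1 n.+1).
  by apply: perm_trans perm2; rewrite -stepE perm_sym perm_reinsert //; case: std.
exists T, (x :: i); split=> //; first by rewrite /= bump stepE.
split; first by rewrite /= szi.
  by move=> y; rewrite inE => /predU1P[->|/subi] //; rewrite -(perm_mem permT).
by rewrite vacillating_fromE stepE sh1 -eqP /= sh.
Qed.

(** This identifies the tableau reached at index 0. *)
Lemma standard_one_row (n : nat) (T : tableau) :
    standard T -> shape T = [:: n] -> perm_eq (flatten T) (iota 1 n) ->
  T = [:: iota 1 n].
Proof.
case: T => [|R [|R' T]] // /standard_cons[_ _ _ row _] _.
rewrite /= cats0 => perm; congr [:: _].
apply: (sorted_eq leq_trans anti_leq) => //; last exact: iota_sorted.
apply/(sortedP 0) => i lt_i; apply/ltnW/row; lia.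
Qed.

Theorem proposition6 (k : nat) (k_gt0 : 0 < k)
    (lam : (k.*2.+1).-tuple (seq nat)) (lam_part : all is_part lam) :
  (exists i : k.-tuple nat,
      {in i, forall x, 0 < x} /\ is_limiting_vacillating_tableau i lam)
  <->
  (nth [::] lam 0 = [::] /\
   forall j : nat, j < k ->
     (part_included (nth [::] lam j.*2.+1) (nth [::] lam j.*2) /\
      (skew_size (nth [::] lam j.*2) (nth [::] lam j.*2.+1) = 0 \/
       skew_size (nth [::] lam j.*2) (nth [::] lam j.*2.+1) = 1)) /\
     (part_included (nth [::] lam j.*2.+1) (nth [::] lam j.*2.+2) /\
      skew_size (nth [::] lam j.*2.+2) (nth [::] lam j.*2.+1) = 1)).
Proof.
split=> [[i [i_gt0 lim]]|[lam0 steps]].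
  pose n := sumn i; pose m := (n + 2 * k).+1.
  have le_n : {in i, forall x, x <= n}.
    by move=> x xi; rewrite /n (perm_sumn (perm_to_rem xi)) /= leq_addr.
  have lamE : tval lam = map star (vacillating_tableau m i).
    by apply: (lim n) => //; rewrite size_tuple.
  rewrite lamE; split=> // j lt_j.
  apply: (@vacillating_from_steps [:: iota 1 m] i); rewrite ?size_tuple //.
  - by apply: (subset_iota i_gt0 le_n); rewrite /m; lia.
  - by apply: (bumping_iota i_gt0 le_n); rewrite size_tuple /m; lia.
(* Twice the size of any partition of the sequence stays below n. *)
pose n := (sumn (map sumn lam)).*2.+1.
have lt_n : all (fun la => (sumn la).*2 < n) lam.
  apply/allP => la la_lam; rewrite /n ltnS leq_double.
  by rewrite (perm_sumn (perm_map sumn (perm_to_rem la_lam))) /= leq_addr.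
have [T [i [std sh perm bump [szi subi eq_lam]]]] :=
  vacillating_realize (size_tuple lam) lam_part lt_n steps.
have T1 : T = [:: iota 1 n.+1].
  by apply: standard_one_row => //; rewrite sh lam0.
rewrite {}T1 in bump eq_lam.
have i_gt0 : {in i, forall x, 0 < x} by move=> x /subi; rewrite mem_iota; lia.
have i_le : {in i, forall x, x <= n.+1} by move=> x /subi; rewrite mem_iota; lia.
have szi' : size i == k by rewrite szi.
exists (Tuple szi'); split=> // N m le_N lt_m; rewrite -eq_lam.
case: (leqP n.+1 m) => [le|lt].
  by rewrite -(vacillating_tableau_stable i_gt0 i_le _ le bump).
apply: (vacillating_tableau_stable i_gt0); try lia.
- by move=> x /le_N /leq_trans; apply; lia.
- by apply: (bumping_iota i_gt0 le_N); move: lt_m => /=; lia.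
Qed.
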